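(* Let $g$ be a coupling function such that the globally coupled system of $N$ phase oscillators $$\frac{d\theta_i}{dt}=\omega+\frac1N\sum_{j=1}^N g(\theta_i-\theta_j),\qquad i=1,\dots,N,$$ has a periodic three-cluster state with nontrivial clusters of sizes $m_1,m_2,m_3$ that is tangentially stable, the clusters being numbered so that $K_1\le K_2\le K_3$, where $$K_1=\frac{1}{m_1}(m_2g'_{12}+m_3g'_{13}),\quad K_2=\frac{1}{m_2}(m_1g'_{21}+m_3g'_{23}),\quad K_3=\frac{1}{m_3}(m_1g'_{31}+m_2g'_{32}).$$ Then there exist a parametrized family of coupling functions $$g_r(\varphi)=g(\varphi)+r\,h(\varphi),\qquad r\in\mathbb{R},$$ with $h$ a coupling function, and parameter values $r_1\le r_2\le r_3$, such that for every $r\in\mathbb{R}$ the cluster state (same partition, same relative phases) is still a periodic cluster state of the system with coupling function $g_r$ and is tangentially stable, and its transverse eigenvalues $\lambda_4^{tran},\lambda_5^{tran},\lambda_6^{tran}$ (computed with $g_r$ in place of $g$) satisfy: (1) if $r<r_1$, then $\lambda_4^{tran},\lambda_5^{tran},\lambda_6^{tran}>0$ (all clusters unstable); (2) if $r_1<r<r_2$, then $\lambda_4^{tran}<0$ and $\lambda_5^{tran},\lambda_6^{tran}>0$ (one stable cluster); (3) if $r_2<r<r_3$, then $\lambda_4^{tran},\lambda_5^{tran}<0$ and $\lambda_6^{tran}>0$ (two stable clusters); (4) if $r_3<r$, then $\lambda_4^{tran},\lambda_5^{tran},\lambda_6^{tran}<0$ (all clusters stable).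
   Context: Here $\mathbb{T}=[0,2\pi)$ is the circle of phases (taken mod $2\pi$), $\theta_i\in\mathbb{T}$, $\omega\in\mathbb{R}$ is a constant, and a coupling function is a smooth $2\pi$-periodic function $\mathbb{T}\to\mathbb{R}$. A periodic three-cluster state is given by a partition of $\{1,\dots,N\}$ into three clusters $p_1,p_2,p_3$ with $|p_k|=m_k$, pairwise distinct relative phases $\phi_1,\phi_2,\phi_3\in\mathbb{T}$ and a frequency $\Omega>0$ such that $\theta_i(t)=\phi_k+\Omega t$ for all $i\in p_k$ solves the system; that is, $\Omega=\omega+\frac1N\sum_{\ell=1}^3 m_\ell\, g(\phi_k-\phi_\ell)$ for $k=1,2,3$. A cluster $p_k$ is nontrivial if $m_k>1$. Notation: $g'_0=g'(0)$ and, for $k\ne\ell$, $g'_{k\ell}=g'(\phi_k-\phi_\ell)$. Tangential stability: perturbations preserving the clustering satisfy, to first order, $\frac{d\chi_k}{dt}=\frac1N\sum_{\ell=1}^3 m_\ell\, g'(\phi_k-\phi_\ell)(\chi_k-\chi_\ell)=\sum_{\ell=1}^3T_{k\ell}\chi_\ell$, i.e. $T_{kk}=\frac1N\sum_{r\neq k}m_r g'_{kr}$ and $T_{k\ell}=-\frac1N m_\ell g'_{k\ell}$ for $\ell\ne k$. The $3\times3$ matrix $T$ always has one trivial eigenvalue $0$ (eigenvector $(1,1,1)$). The state is tangentially stable if the other two eigenvalues of $T$ (counted with multiplicity) have negative real parts. Transverse eigenvalues: the eigenvalues of the linearization of the system about the state (in the co-rotating frame) for perturbations that split one cluster are $$\lambda_4^{tran}=\tfrac1N(m_1g'_0+m_2g'_{12}+m_3g'_{13}),\quad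 \lambda_5^{tran}=\tfrac1N(m_1g'_{21}+m_2g'_0+m_3g'_{23}),\quad \lambda_6^{tran}=\tfrac1N(m_1g'_{31}+m_2g'_{32}+m_3g'_0),$$ associated with clusters $1,2,3$ respectively. A cluster is called stable (unstable) if its transverse eigenvalue is negative (positive). *)

(* Defs.v *)
From HB Require Import structures.
From mathcomp Require Import all_boot all_order all_algebra.
From mathcomp Require Import complex.
From mathcomp Require Import all_classical all_reals all_analysis.

Set Implicit Arguments.
Unset Strict Implicit.
Unset Printing Implicit Defensive.

Import Order.TTheory GRing.Theory Num.Theory.
Import numFieldNormedType.Exports.
Local Open Scope ring_scope.

Definition k1 : 'I_3 := @Ordinal 3 0 isT.
Definition k2 : 'I_3 := @Ordinal 3 1 isT.
Definition k3 : 'I_3 := @Ordinal 3 2 isT.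

(* Functions on the circle are represented by their periodic lifts to the
   real line. *)
Definition coupling_function (R : realType) (g : R -> R) : Prop :=
  (forall (n : nat) (x : R), derivable (derive1n n g) x 1) /\
  periodic g (pi *+ 2).

(* The phases theta i are real-valued lifts of the phases on the circle; by
   periodicity of g the right-hand side does not depend on the lift. *)
Definition is_solution (R : realType) (N : nat) (omega : R) (g : R -> R)
    (theta : 'I_N -> R -> R) : Prop :=
  forall (i : 'I_N) (t : R),
    is_derive t 1 (theta i)
      (omega + N%:R^-1 * \sum_(j < N) g (theta i t - theta j t)).

(* An ordered partition of the oscillators into three clusters is encoded by
   its labelling cl : the cluster with label k is the fibre of cl over k. *)
Definition cluster_set (N : nat) (cl : 'I_N -> 'I_3) (k : 'I_3) : {set 'I_N} :=
  [set i | cl i == k].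

Definition cluster_size (N : nat) (cl : 'I_N -> 'I_3) (k : 'I_3) : nat :=
  #|cluster_set cl k|.

Definition periodic_three_cluster_state (R : realType) (N : nat) (omega : R)
    (g : R -> R) (cl : 'I_N -> 'I_3) (phi : 'I_3 -> R) (Omega : R) : Prop :=
  [/\ forall k, cluster_set cl k != finset.set0,
      forall k, 0 <= phi k < pi *+ 2,
      injective phi,
      0 < Omega &
      is_solution omega g (fun i t => phi (cl i) + Omega * t)].

Definition nontrivial_cluster (N : nat) (cl : 'I_N -> 'I_3) (k : 'I_3) : Prop :=
  (1 < cluster_size cl k)%N.

Definition tangential_matrix (R : realType) (N : nat) (g : R -> R)
    (cl : 'I_N -> 'I_3) (phi : 'I_3 -> R) : 'M[R]_3 :=
  \matrix_(k, l)
    if k == l then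
      N%:R^-1 * \sum_(r | r != k)
        (cluster_size cl r)%:R * derive1 g (phi k - phi r)
    else
      - (N%:R^-1 * (cluster_size cl l)%:R * derive1 g (phi k - phi l)).

(* s lists the complex eigenvalues of the real matrix A with their algebraic
   multiplicities. *)
Definition eigenvalue_list (R : realType) (n : nat) (A : 'M[R]_n)
    (s : seq R[i]) : Prop :=
  char_poly (map_mx (real_complex R) A) = \prod_(a <- s) ('X - a%:P).

Definition tangentially_stable (R : realType) (N : nat) (g : R -> R)
    (cl : 'I_N -> 'I_3) (phi : 'I_3 -> R) : Prop :=
  exists mu1 mu2 : R[i],
    [/\ eigenvalue_list (tangential_matrix g cl phi) [:: 0; mu1; mu2],
        complex.Re mu1 < 0 & complex.Re mu2 < 0].

Definition transverse_eigenvalue (R : realType) (N : nat) (g : R -> R)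
    (cl : 'I_N -> 'I_3) (phi : 'I_3 -> R) (k : 'I_3) : R :=
  N%:R^-1 * ((cluster_size cl k)%:R * derive1 g 0 +
    \sum_(l | l != k) (cluster_size cl l)%:R * derive1 g (phi k - phi l)).

Definition Kcoef (R : realType) (N : nat) (g : R -> R)
    (cl : 'I_N -> 'I_3) (phi : 'I_3 -> R) (k : 'I_3) : R :=
  (cluster_size cl k)%:R^-1 *
    \sum_(l | l != k) (cluster_size cl l)%:R * derive1 g (phi k - phi l).

(* Main.v *)
Require Import Defs.
From HB Require Import structures.
From mathcomp Require Import all_boot all_order all_algebra.
From mathcomp Require Import complex lra.
From mathcomp Require Import all_classical all_reals all_analysis.

Import Order.TTheory GRing.Theory Num.Theory.
Import numFieldNormedType.Exports.
Local Open Scope ring_scope.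

(* The quantities defining the state and its tangential matrix involve g and g'
   only at 0 and at the differences phi_k - phi_l, and g'(0) enters only the
   transverse eigenvalues.  Hence it is enough to take a trigonometric
   polynomial h that vanishes at all these points, with h'(0) = -1 and h' = 0 at
   the nonzero differences: the state and its tangential matrix do not move, and
   the k-th transverse eigenvalue becomes (m_k / N) (g'(0) + K_k - r), so that
   r_k = g'(0) + K_k. *)

(* Sines are covered by phase shifts, which makes the class closed under
   differentiation. *)
Inductive trigonometric (R : realType) : (R -> R) -> Prop :=
| trigonometric_cst (c : R) : trigonometric R (fun=> c)
| trigonometric_cos (a : R) : trigonometric R (fun x => cos (x - a))
| trigonometric_add (f h : R -> R) : trigonometric R f -> trigonometric R h ->
    trigonometric R (fun x => f x + h x)
| trigonometric_mul (f h : R -> R) : trigonometric R f -> trigonometric R h ->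
    trigonometric R (fun x => f x * h x).

Lemma is_derive_cosB (R : realType) (a x : R) :
  is_derive x 1 (fun y : R => cos (y - a)) (- sin (x - a)).
Proof.
have ds : is_derive x 1 (fun y : R => y - a) 1.
  by apply: is_derive_eq; rewrite subr0.
rewrite -[- sin _]mulr1; exact: (is_derive1_comp (is_derive_cos _) ds).
Qed.

Lemma trigonometric_derivative (R : realType) (f : R -> R) :
  trigonometric R f -> exists2 df : R -> R,
    trigonometric R df & forall x : R, is_derive x 1 f (df x).
Proof.
elim=> [c|a|u v tu [du tdu uP] tv [dv tdv vP]|u v tu [du tdu uP] tv [dv tdv vP]].
- by exists (fun=> 0); [exact: trigonometric_cst|move=> x; exact: is_derive_cst].
(* A quarter-period shift turns cosine into minus sine, so the derivative is again a generator of
   the class. *)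
- exists (fun x => cos (x - (a - pi / 2))); first exact: trigonometric_cos.
  move=> x; apply: is_derive_eq (is_derive_cosB R a x) _.
  by rewrite opprB addrCA addrC cosDpihalf.
- exists (fun x => du x + dv x); first exact: trigonometric_add.
  by move=> x; exact: is_deriveD.
- exists (fun x => u x * dv x + v x * du x).
    by apply: trigonometric_add; apply: trigonometric_mul.
  by move=> x; exact: is_deriveM.
Qed.

Lemma trigonometric_derive1n (R : realType) (n : nat) (f : R -> R) :
  trigonometric R f -> trigonometric R (derive1n n f).
Proof.
move=> tf; elim: n => // n /trigonometric_derivative[df tdf dfP].
suff -> : derive1n n.+1 f = df by [].
by apply/funext => x; rewrite derive1nS derive1E; apply: derive_val.
Qed.

Lemma trigonometric_coupling (R : realType) (f : R -> R) :
  trigonometric R f -> coupling_function f.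
Proof.
move=> tf; split=> [n x|].
  by have [df _ dfP] := trigonometric_derivative R _ (trigonometric_derive1n R n f tf).
elim: tf => [c|a|u v _ up _ vp|u v _ up _ vp] x; rewrite ?up ?vp //.
by rewrite addrAC cosD2pi.
Qed.

(** Evenness reduces to positive [d], where [sin (d / 2)] is positive; [cos d = 1] would force
    [cos (d / 2) ^ 2 = 1], contradicting the Pythagorean identity. *)
Lemma cos_neq1 (R : realType) (d : R) :
  d != 0 -> `|d| < pi *+ 2 -> cos d != 1.
Proof.
wlog d_gt0 : d / 0 < d => [hw|] d0 dlt.
  have [d_gt0|d_le0] := ltP 0 d; first exact: hw.
  by rewrite -cosN; apply: hw; rewrite ?oppr_eq0 ?normrN // oppr_gt0 lt_neqAle d0.
have s_gt0 : 0 < sin (d / 2).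
  apply: sin_gt0_pi; move: dlt; rewrite gtr0_norm //.
  by rewrite mulr2n; lra.
apply/eqP => cd1; have := cos2Dsin2 (d / 2).
have : cos (d / 2 *+ 2) = 1 by rewrite -mulr_natr mulfVK.
by rewrite cos_mulr2n !expr2; nra.
Qed.

(** Start from sine and multiply, for each [d] in [s], by a factor with a double zero at [d] and
    value 1 at 0. Earlier double zeros survive, and since [h 0 = 0] the slope at 0 stays 1. *)
Lemma trigonometric_interpolation (R : realType) (s : seq R) :
  {in s, forall d, cos d != 1} ->
  exists h : R -> R, [/\ trigonometric R h, h 0 = 0, is_derive (0 : R) 1 h 1 &
    {in s, forall d, h d = 0 /\ is_derive (d : R) 1 h 0}].
Proof.
elim: s => [_|d s IH sP].
  exists (fun x => cos (x - pi / 2)); split=> //; first exact: trigonometric_cos.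
    by rewrite cosBpihalf sin0.
  apply: is_derive_eq (is_derive_cosB R _ _) _.
  by rewrite sub0r sinN sin_pihalf opprK.
have [|h [th h0 dh0 hP]] := IH.
  by move=> e es; apply: sP; rewrite inE es orbT.
have cd : 1 - cos d != 0 by rewrite subr_eq0 eq_sym sP ?mem_head.
(* [1 - cos (x - d)] has its minimum, hence a double zero, at [d]; dividing by its value at 0,
   nonzero by [cd], gives [w 0 = 1]. *)
pose w x := (1 - cos d)^-1 * (1 + (-1) * cos (x - d)).
have dw (x : R) : is_derive x 1 w ((1 - cos d)^-1 * sin (x - d)).
  have dc := is_derive_cosB R d x.
  apply: is_derive_eq.
  by rewrite add0r mul1r scaleN1r opprK.
exists (fun x => h x * w x).
have dhw (x a : R) : is_derive x 1 h a ->
    is_derive x 1 (fun y => h y * w y)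
      (h x * ((1 - cos d)^-1 * sin (x - d)) + w x * a).
  by move=> dh; exact: is_deriveM.
split.
- do 2![apply: trigonometric_mul; first by [|exact: trigonometric_cst]].
  apply: trigonometric_add; first exact: trigonometric_cst.
  by apply: trigonometric_mul; [exact: trigonometric_cst|exact: trigonometric_cos].
- by rewrite h0 mul0r.
- apply: is_derive_eq (dhw _ _ dh0) _.
  by rewrite h0 mul0r add0r mulr1 /w sub0r cosN mulN1r mulVf.
- move=> e; rewrite inE => /predU1P[->|es].
    have wd : w d = 0 by rewrite /w subrr cos0 mulN1r subrr mulr0.
    rewrite wd mulr0; split=> //.
    (* The slope of [h] at the new point [d] is unknown, but only its existence matters: it is
       multiplied by [w d = 0]. *)
    have [dh _ /(_ d) dhP] := trigonometric_derivative R _ th.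
    apply: is_derive_eq (dhw _ _ dhP) _.
    by rewrite wd subrr sin0 !(mulr0, mul0r) addr0.
  have [he dhe] := hP e es; rewrite he mul0r; split=> //.
  by apply: is_derive_eq (dhw _ _ dhe) _; rewrite he mul0r mulr0 addr0.
Qed.

Lemma coupling_perturbation (R : realType) (phi : 'I_3 -> R) :
  (forall k, 0 <= phi k < pi *+ 2) -> injective phi ->
  exists h : R -> R, [/\ coupling_function h,
    forall k l, h (phi k - phi l) = 0, derive1 h 0 = -1 &
    forall k l, k != l -> derive1 h (phi k - phi l) = 0].
Proof.
move=> phi_range phi_inj.
(* Diagonal pairs are left out: their difference is 0, where the slope must be nonzero. The other
   differences are nonzero and smaller than a period. *)
pose s := [seq phi p.1 - phi p.2 | p <- enum [pred p : 'I_3 * 'I_3 | p.1 != p.2]].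
have [d /mapP[[k l]]|h [th h0 dh0 hP]] := trigonometric_interpolation R s.
  rewrite mem_enum inE /= => kl ->; apply: cos_neq1.
    by rewrite subr_eq0; apply: contra kl => /eqP/phi_inj ->.
  have /andP[? ?] := phi_range k; have /andP[? ?] := phi_range l.
  by rewrite ltr_norml; apply/andP; split; lra.
have sP k l : k != l -> phi k - phi l \in s.
  by move=> kl; apply/mapP; exists (k, l); rewrite // mem_enum inE.
have dN (x a : R) : is_derive x 1 h a -> derive1 (fun y => -1 * h y) x = - a.
  move=> dh; rewrite derive1E; apply: derive_val.
  by apply: is_derive_eq; rewrite scaleN1r.
(* The sign makes the transverse eigenvalues decrease as [r] grows. *)
exists (fun x => -1 * h x); split.
- by apply/trigonometric_coupling/trigonometric_mul => //; exact: trigonometric_cst.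
- move=> k l; have [->|kl] := eqVneq k l; first by rewrite subrr h0 mulr0.
  by rewrite (hP _ (sP _ _ kl)).1 mulr0.
- exact: dN.
- by move=> k l kl; rewrite -oppr0; apply: dN; exact: (hP _ (sP _ _ kl)).2.
Qed.

(** Along the state the common drift [Omega * t] cancels in every phase difference, so the coupling
    is sampled only at the values [phi k - phi l]. *)
Lemma cluster_state_coupling_ext (R : realType) (N : nat) (omega : R)
    (f g : R -> R) (cl : 'I_N -> 'I_3) (phi : 'I_3 -> R) (Omega : R) :
  (forall k l, f (phi k - phi l) = g (phi k - phi l)) ->
  periodic_three_cluster_state omega g cl phi Omega ->
  periodic_three_cluster_state omega f cl phi Omega.
Proof.
move=> fg [ne range inj Omega0 sol]; split=> // i t.
apply: is_derive_eq (sol i t) _; congr (_ + _ * _).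
by apply: eq_bigr => j _; rewrite opprD addrACA subrr addr0 fg.
Qed.

Lemma tangential_matrix_ext (R : realType) (N : nat) (f g : R -> R)
    (cl : 'I_N -> 'I_3) (phi : 'I_3 -> R) :
  (forall k l, k != l ->
    derive1 f (phi k - phi l) = derive1 g (phi k - phi l)) ->
  tangential_matrix f cl phi = tangential_matrix g cl phi.
Proof.
move=> fg; apply/matrixP => k l; rewrite !mxE; case: eqVneq => [_|kl].
  by congr (_ * _); apply: eq_bigr => r rk; rewrite fg // eq_sym.
by rewrite fg.
Qed.

Lemma transverse_eigenvalueE (R : realType) (N : nat) (g : R -> R)
    (cl : 'I_N -> 'I_3) (phi : 'I_3 -> R) (k : 'I_3) :
  (0 < cluster_size cl k)%N ->
  transverse_eigenvalue g cl phi k =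
  N%:R^-1 * (cluster_size cl k)%:R * (derive1 g 0 + Kcoef g cl phi k).
Proof.
move=> m0; rewrite /Kcoef -mulrA mulrDr mulVKf //.
by rewrite pnatr_eq0 -lt0n.
Qed.

Theorem corollary5 (R : realType) (N : nat) (omega : R) (g : R -> R)
    (cl : 'I_N -> 'I_3) (phi : 'I_3 -> R) (Omega : R)
    (g_coupling : coupling_function g)
    (state : periodic_three_cluster_state omega g cl phi Omega)
    (nontrivial : forall k : 'I_3, nontrivial_cluster cl k)
    (stable : tangentially_stable g cl phi)
    (K12 : Kcoef g cl phi k1 <= Kcoef g cl phi k2)
    (K23 : Kcoef g cl phi k2 <= Kcoef g cl phi k3) :
  exists (h : R -> R) (r1 r2 r3 : R),
    [/\ coupling_function h, r1 <= r2, r2 <= r3 &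
      forall r : R,
        let g_r := fun x : R => g x + r * h x in
        let lambda4 := transverse_eigenvalue g_r cl phi k1 in
        let lambda5 := transverse_eigenvalue g_r cl phi k2 in
        let lambda6 := transverse_eigenvalue g_r cl phi k3 in
        (exists Omega_r : R,
           periodic_three_cluster_state omega g_r cl phi Omega_r) /\
        tangentially_stable g_r cl phi /\
        (r < r1 -> [/\ 0 < lambda4, 0 < lambda5 & 0 < lambda6]) /\
        (r1 < r < r2 -> [/\ lambda4 < 0, 0 < lambda5 & 0 < lambda6]) /\
        (r2 < r < r3 -> [/\ lambda4 < 0, lambda5 < 0 & 0 < lambda6]) /\
        (r3 < r -> [/\ lambda4 < 0, lambda5 < 0 & lambda6 < 0])].
Proof.
have [_ phi_range phi_inj _ _] := state.
have [h [hc h0 dh0 dh]] := coupling_perturbation R phi phi_range phi_inj.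
pose rr k := derive1 g 0 + Kcoef g cl phi k.
have r12 : rr k1 <= rr k2 by rewrite lerD2l.
have r23 : rr k2 <= rr k3 by rewrite lerD2l.
exists h, (rr k1), (rr k2), (rr k3).
split; [exact: hc|exact: r12|exact: r23|move=> r g_r l4 l5 l6].
have dg_r x : derive1 g_r x = derive1 g x + r * derive1 h x.
  have dg : derivable g x 1 by exact: (g_coupling.1 0%N).
  have dhx : derivable h x 1 by exact: (hc.1 0%N).
  have -> : g_r = g + r \*: h by [].
  by rewrite !derive1E deriveD ?deriveZ //; exact: derivableZ.
have dg_rE k l : k != l ->
    derive1 g_r (phi k - phi l) = derive1 g (phi k - phi l).
  by move=> kl; rewrite dg_r dh // mulr0 addr0.
have lE k : transverse_eigenvalue g_r cl phi k =
    N%:R^-1 * (cluster_size cl k)%:R * (rr k - r).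
  rewrite transverse_eigenvalueE; last exact/ltnW/nontrivial.
  rewrite dg_r dh0 mulrN1 addrAC; congr (_ * (_ + _ - _)).
  by congr (_ * _); apply: eq_bigr => l lk; rewrite dg_rE // eq_sym.
have c_gt0 k : 0 < N%:R^-1 * (cluster_size cl k)%:R :> R.
  have mk : (0 < cluster_size cl k)%N by exact/ltnW/nontrivial.
  rewrite mulr_gt0 ?invr_gt0 ?ltr0n //.
  (* [N] is positive because it bounds the size of a nonempty cluster. *)
  by rewrite (leq_trans mk) // -[leqRHS]card_ord max_card.
(* With the positive factor removed, each sign depends only on the side of [rr k] on which [r] lies,
   so the four regimes follow from the ordering of the thresholds. *)
have l_gt0 k : (0 < transverse_eigenvalue g_r cl phi k) = (r < rr k).
  by rewrite lE pmulr_rgt0 ?subr_gt0.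
have l_lt0 k : (transverse_eigenvalue g_r cl phi k < 0) = (rr k < r).
  by rewrite lE pmulr_rlt0 ?subr_lt0.
split.
  exists Omega; apply: cluster_state_coupling_ext state => k l.
  by rewrite /g_r h0 mulr0 addr0.
split; first by rewrite /tangentially_stable (tangential_matrix_ext _ _ g_r g).
rewrite /l4 /l5 /l6 !l_gt0 !l_lt0; clearbody rr.
move: r12 r23; clear.
by move=> r12 r23; split=> [?|];
  [|split=> [/andP[? ?]|]; [|split=> [/andP[? ?]|?]]]; split; lra.
Qed.
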